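(* For every positive integer $k$ there are integers $m,n<4k^4$, matrices $A\in\{-1,0,1,2\}^{m\times n}$ and $W\in\{0,1\}^{2\times n}$, and lower and upper bound vectors $l\in\{-\infty,0\}^n$, $u\in\{1,\infty\}^n$, such that the integer hull $Q:={\rm conv}\{x\in\mathbb{Z}^n : Ax=0,\ l\le x\le u\}$ is a polytope whose projection $\{Wx : x\in Q\}$ by $W$ into the plane $\mathbb{R}^2$ has exactly $2^k$ vertices.
   Context: The inequalities $l\le x\le u$ are componentwise, where an entry $-\infty$ of $l$ (resp. $\infty$ of $u$) means no lower (resp. upper) bound on that coordinate. *)

(* Defs.v *)
From HB Require Import structures.
From mathcomp Require Import all_boot all_order all_algebra.
From mathcomp Require Import all_classical all_reals convex.

Set Implicit Arguments.
Unset Strict Implicit.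
Unset Printing Implicit Defensive.

Import Order.TTheory GRing.Theory Num.Theory.

Local Open Scope classical_set_scope.
Local Open Scope ring_scope.

Definition convex_hull (R : realType) (d : nat) (S : set 'cV[R]_d) :
    set 'cV[R]_d :=
  smallest (@convex_set R 'cV[R]_d) S.

Definition is_polytope (R : realType) (d : nat) (P : set 'cV[R]_d) : Prop :=
  exists2 V : set 'cV[R]_d, finite_set V & P = convex_hull V.

Definition is_face (R : realType) (d : nat) (P F : set 'cV[R]_d) : Prop :=
  exists (c : 'rV[R]_d) (b : R),
    (forall x, P x -> (c *m x) 0 0 <= b) /\
    F = [set x | P x /\ (c *m x) 0 0 = b].

(* A vertex is a face of dimension zero. *)
Definition vertices (R : realType) (d : nat) (P : set 'cV[R]_d) :
    set 'cV[R]_d :=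
  [set v | is_face P [set v]].

Definition integer_hull (R : realType) (m n : nat) (A : 'M[R]_(m, n))
    (l u : 'cV[\bar R]_n) : set 'cV[R]_n :=
  convex_hull
    [set x : 'cV[R]_n |
      [/\ forall j, x j 0 \is a Num.int,
          A *m x = 0 &
          forall j, (l j 0%R <= (x j 0%R)%:E <= u j 0%R)%E]].

(* Main.v *)
Require Import Defs.
From HB Require Import structures.
From mathcomp Require Import all_boot all_order all_algebra.
From mathcomp Require Import all_classical all_reals convex.
From mathcomp Require Import interval_inference zify ring lra.

Set Implicit Arguments.
Unset Strict Implicit.
Unset Printing Implicit Defensive.

Import Order.TTheory GRing.Theory Num.Theory.

Local Open Scope classical_set_scope.
Local Open Scope ring_scope.

(* The planar point set {(a, a^2) : 0 <= a < 2^k} is in convex position, since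
   the tangent of the parabola at each of its points exposes that point; so it
   suffices to make it the image of the integer points of the system. Writing
   a in binary with digits b_i, one has a = sum_i 2^i b_i and
   a^2 = sum_(i, j) 2^(i + j) b_i b_j. Over 0/1 unknowns the product
   y = b_i b_j is linearised by b_i + b_j = 2 y + s (carry and sum bit of a
   half adder), and multiplications by powers of 2 become chains of equations
   2 z = z', so all coefficients lie in {-1, 0, 1, 2} and W only has to add up
   the right members of the chains. *)

(** * Vertices of linear images of convex hulls *)

(** Excluding [t = 0] and [t = 1] makes a mix of a point strictly below a hyperplane and a point on
    it strictly below again. *)
Lemma convex_hull_sub (R : realType) (d : nat) (S M : set 'cV[R]_d) :
  S `<=` M ->
  (forall x y (t : R), 0 < t -> t < 1 -> M x -> M y ->
     M (t *: x + (1 - t) *: y)) ->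
  convex_hull S `<=` M.
Proof.
move=> SM cM; apply: smallest_sub => //; apply/convex_setW => x y xM yM t t0 t1.
by apply/mem_set; apply: (cM x y t%:num t0 t1 (set_mem xM) (set_mem yM)).
Qed.

Lemma sub_convex_hull (R : realType) (d : nat) (S : set 'cV[R]_d) :
  S `<=` convex_hull S.
Proof. exact: sub_gen_smallest. Qed.

Lemma mul_col_comb (R : realType) (d n : nat) (c : 'rV[R]_d) (W : 'M[R]_(d, n))
    (x y : 'cV[R]_n) (t : R) :
  (c *m (W *m (t *: x + (1 - t) *: y))) 0 0 =
  t * (c *m (W *m x)) 0 0 + (1 - t) * (c *m (W *m y)) 0 0.
Proof. by rewrite !mulmxDr -!scalemxAr !mxE. Qed.

(** If no point of [S] maps to [v], the functional exposing [v] is [< b] at the image of every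
    generator. This strict inequality is convex, so it extends to the hull and excludes a preimage
    of [v] there. *)
Lemma vertex_image_hull (R : realType) (d n : nat) (W : 'M[R]_(d, n))
    (S : set 'cV[R]_n) (v : 'cV[R]_d) :
  vertices [set W *m x | x in convex_hull S] v -> exists2 s, S s & W *m s = v.
Proof.
move=> [c [b [cb Fv]]]; apply: contrapT => noS.
have : [set v] v by [].
rewrite Fv => -[[y Sy yv] cvb].
have cS x : convex_hull S x -> (c *m (W *m x)) 0 0 <= b.
  by move=> Sx; apply: cb; exists x.
suff : (c *m (W *m y)) 0 0 < b by rewrite yv cvb ltxx.
apply: (@convex_hull_sub R n S (fun x => (c *m (W *m x)) 0 0 < b)) Sy.
  move=> s Ss; rewrite lt_neqAle cS ?andbT; last exact: sub_convex_hull.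
  apply/eqP => sb; apply: noS; exists s => //.
  suff : [set v] (W *m s) by [].
  by rewrite Fv; split=> //; exists s => //; apply: sub_convex_hull.
by move=> x z t t0 t1; rewrite mul_col_comb; nra.
Qed.

(** The alternative [< b] or same image as [s] survives convex combinations, so it passes from [S]
    to its hull. *)
Lemma exposed_vertex_image_hull (R : realType) (d n : nat) (W : 'M[R]_(d, n))
    (S : set 'cV[R]_n) (c : 'rV[R]_d) (b : R) (s : 'cV[R]_n) :
  S s -> (c *m (W *m s)) 0 0 = b ->
  (forall x, S x -> (c *m (W *m x)) 0 0 < b \/ W *m x = W *m s) ->
  vertices [set W *m x | x in convex_hull S] (W *m s).
Proof.
move=> Ss sb Sb; exists c, b.
have hullb x : convex_hull S x -> (c *m (W *m x)) 0 0 < b \/ W *m x = W *m s.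
  apply: (@convex_hull_sub R n S
    (fun x => (c *m (W *m x)) 0 0 < b \/ W *m x = W *m s)) => // y z t t0 t1.
  rewrite mul_col_comb => -[yb|yE] [zb|zE].
  - by left; nra.
  - by left; rewrite zE sb; nra.
  - by left; rewrite yE sb; nra.
  - by right; rewrite mulmxDr -!scalemxAr yE zE -scalerDl addrC subrK scale1r.
split=> [_ [x Sx <-]|].
  by case: (hullb x Sx) => [/ltW//|->]; rewrite sb.
apply/seteqP; split=> [_ -> | _ [[x Sx <-] xb]].
  by split=> //; exists s => //; apply: sub_convex_hull.
by case: (hullb x Sx) => //; rewrite xb ltxx.
Qed.

(** * Points on the parabola *)

Definition parabola_point (R : realType) (a : nat) : 'cV[R]_2 :=
  \col_i (if i == 0 then a%:R else a%:R ^+ 2).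

Lemma parabola_point_inj (R : realType) : injective (@parabola_point R).
Proof.
by move=> a b /colP/(_ 0); rewrite !mxE => /eqP; rewrite eqr_nat => /eqP.
Qed.

Lemma vertices_parabola (R : realType) (n N : nat) (W : 'M[R]_(2, n))
    (S : set 'cV[R]_n) :
  [set W *m x | x in S] = [set parabola_point R a | a in `I_N] ->
  vertices [set W *m x | x in convex_hull S] =
  [set parabola_point R a | a in `I_N].
Proof.
move=> WS; apply/seteqP; split=> [v /vertex_image_hull[s Ss <-]|_ [a aN <-]].
  by rewrite -WS; exists s.
have : [set parabola_point R a | a in `I_N] (parabola_point R a) by exists a.
rewrite -WS => -[s Ss sa]; rewrite -sa.
(* The tangent of the parabola at [a] exposes the point. *)
pose c : 'rV[R]_2 := \row_i (if i == 0 then 2 * a%:R else - 1).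
(* Completing the square shows that the maximum is attained only at [e = a]. *)
have cE e : (c *m parabola_point R e) 0 0 = a%:R ^+ 2 - (e%:R - a%:R) ^+ 2.
  by rewrite mxE !big_ord_recl big_ord0 !mxE /=; ring.
apply: (@exposed_vertex_image_hull _ _ _ _ _ c (a%:R ^+ 2)) => //.
  by rewrite sa cE subrr expr0n subr0.
move=> x Sx; have : [set W *m x | x in S] (W *m x) by exists x.
rewrite WS => -[e eN <-]; have [->|ea] := eqVneq e a.
  by right; rewrite sa.
left; rewrite cE ltrBlDr ltrDl exprn_even_gt0 //=.
by rewrite subr_eq0 eqr_nat.
Qed.

(** * Binary expansions *)

Definition binary_value (k : nat) (b : {ffun 'I_k -> bool}) : nat :=
  (\sum_(i < k) b i * 2 ^ i)%N.

Lemma range_binary_value (k : nat) : range (@binary_value k) = `I_(2 ^ k).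
Proof.
apply/seteqP; split=> [_ [b _ <-]|a] /=.
  have := predn_exp 2 k; rewrite mul1n => sumE.
  apply: (@leq_ltn_trans (2 ^ k).-1); last by rewrite prednK ?expn_gt0.
  by rewrite sumE; apply: leq_sum => i _; case: (b i); rewrite ?mul1n.
(* Digits indexed by [nat] can be shifted in the induction: the lowest is the parity of [a], the
   others are those of its half. *)
have bits m : (a < 2 ^ m)%N ->
    exists b : nat -> bool, (\sum_(i < m) b i * 2 ^ i)%N = a.
  elim: m a => [|m IHm] a am; first by exists xpredT; rewrite big_ord0; lia.
  have [|b bE] := IHm a./2; first by move: am; rewrite expnS; lia.
  exists (fun i => if i is i'.+1 then b i' else odd a).
  rewrite big_ord_recl /= expn0 muln1 -[RHS]odd_double_half -bE -muln2.
  rewrite big_distrl; congr addn; apply: eq_bigr => i _.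
  by rewrite expnS mulnCA mulnC.
move=> /bits[b bE]; exists [ffun i : 'I_k => b i] => //.
by rewrite -bE; apply: eq_bigr => i _; rewrite ffunE.
Qed.

(** * The linear system and its integer solutions *)

(* For [t < 2k], the unknown [(i, j, t)] carries [2^t b_i b_j], where
   [b_i] is the unknown [(i, i, 0)]; the unknown [(i, j, 2k)] is the slack
   of the equation linearising the product [b_i b_j]. *)
Definition unknown (k : nat) : finType := ('I_k * 'I_k * 'I_(2 * k).+1)%type.

Definition equation (k : nat) : finType := ('I_k * 'I_k * 'I_(2 * k))%type.

(* Row [t = 0] is the linearisation of [b_i b_j]; it subtracts the doubled
   product [(i, j, 1)], so that no coefficient [-2] appears even for [i = j]. *)
Definition equation_coef (R : realType) (k : nat) (r : equation k)
    (v : unknown k) : R :=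
  let: (i, j, t) := r in
  if t == 0 :> nat then
    (v == (i, i, ord0))%:R + (v == (j, j, ord0))%:R
    - (v == (i, j, inord 1))%:R - (v == (i, j, ord_max))%:R
  else 2 * (v == (i, j, inord t.-1))%:R - (v == (i, j, inord t))%:R.

(** As [b_i b_i = b_i], row 0 collects the terms [2^i b_i] of [a] from the diagonal chains. Row 1
    collects the terms [2^(i + j) b_i b_j] of [a^2]; chains stopping at [2k - 1] are long enough,
    since [i + j <= 2k - 2]. *)
Definition weight (k : nat) (a : 'I_2) (v : unknown k) : bool :=
  let: (i, j, t) := v in
  if a == 0 then (i == j) && (t == inord i) else t == inord (i + j).

(** Only products and slacks have to be 0/1; the chains determine the other unknowns. *)
Definition upper_bound (R : realType) (k : nat) (v : unknown k) : \bar R :=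
  if (v.2 == ord0) || (v.2 == ord_max) then 1%:E else +oo%E.

Definition solution (R : realType) (k : nat) (b : {ffun 'I_k -> bool})
    (v : unknown k) : R :=
  let: (i, j, t) := v in
  if t == ord_max then ((b i + b j)%:R - (b i && b j)%:R *+ 2)
  else 2 ^+ t * (b i && b j)%:R.

Lemma equation_coef_in (R : realType) (k : nat) (r : equation k) v :
  equation_coef R r v \in [:: -1; 0; 1; 2].
Proof.
case: r => [[i j] t] /=; have t2k := ltn_ord t.
have -> : (2 : R) = 1 + 1 by [].
case: ifP => _.
  (* The two subtracted indicators are never both 1, because [1 < 2k]; this excludes the coefficient
     -2. *)
  have ne : ~~ ((v == (i, j, inord 1)) && (v == (i, j, ord_max))).
    apply/andP => -[/eqP -> /eqP[/(congr1 val)]]; rewrite /= inordK; lia.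
  move: ne; case: (_ == _); case: (_ == _); case: (_ == _); case: (_ == _);
    move=> //= _; rewrite !inE ?mulr0n ?mulr1n ?subr0 ?addr0 ?add0r ?addrK
      ?subrr ?sub0r ?eqxx ?orbT //.
by case: (_ == _); case: (_ == _); rewrite !inE /= ?mulr0 ?mulr1
  ?subr0 ?addr0 ?sub0r ?addrK ?eqxx ?orbT.
Qed.

Lemma sum_unknown (R : realType) (k : nat) (y : unknown k -> R)
    (u : unknown k) :
  \sum_v (v == u)%:R * y v = y u.
Proof.
rewrite (big_only1 u) // => [|v /negbTE -> _]; last by rewrite mul0r.
by rewrite eqxx mul1r.
Qed.

Definition satisfies (R : realType) (k : nat) (y : unknown k -> R)
    (r : equation k) : Prop :=
  let: (i, j, t) := r in
  if t == 0 :> nat then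
    y (i, i, ord0) + y (j, j, ord0) - y (i, j, inord 1) - y (i, j, ord_max) = 0
  else 2 * y (i, j, inord t.-1) = y (i, j, inord t).

Lemma equation_coefE (R : realType) (k : nat) (y : unknown k -> R)
    (r : equation k) :
  \sum_v equation_coef R r v * y v = 0 <-> satisfies y r.
Proof.
case: r => [[i j] t] /=; case: ifP => _.
  under eq_bigr do rewrite !mulrBl mulrDl.
  by rewrite !sumrB big_split /= !sum_unknown.
under eq_bigr do rewrite mulrBl -mulrA.
rewrite sumrB -mulr_sumr !sum_unknown; split; first exact: subr0_eq.
by move=> ->; rewrite subrr.
Qed.

Lemma int_01 (R : realType) (x : R) :
  x \is a Num.int -> 0 <= x -> x <= 1 -> x = 0 \/ x = 1.
Proof.
move=> /intrP[z ->]; rewrite ler0z lerz1 => z0 z1.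
have [->|->] : z = 0 \/ z = 1 by lia.
  by left.
by right.
Qed.

Lemma solution_inord (R : realType) (k : nat) (b : {ffun 'I_k -> bool})
    (i j : 'I_k) (s : nat) :
  (s < 2 * k)%N ->
  solution R b (i, j, inord s) = 2 ^+ s * (b i && b j)%:R.
Proof.
move=> sk; rewrite /= inordK; last lia.
by rewrite ifF //; apply/eqP => /(congr1 val); rewrite /= inordK; lia.
Qed.

Lemma solutions_of_system (R : realType) (k : nat) (y : unknown k -> R) :
  ((forall v, y v \is a Num.int) /\
   (forall r, satisfies y r) /\
   (forall v, (0%:E <= (y v)%:E <= upper_bound R v)%E)) <->
  exists b, forall v, y v = solution R b v.
Proof.
split.
  move=> [yint [ysat ybd]].
  have y01 v : v.2 = ord0 \/ v.2 = ord_max -> y v = 0 \/ y v = 1.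
    move=> v2; have := ybd v; rewrite /upper_bound.
    rewrite (_ : _ || _); last by case: v2 => ->; rewrite eqxx ?orbT.
    by rewrite !lee_fin => /andP[? ?]; apply: int_01.
  exists [ffun i => y (i, i, ord0) == 1] => -[[i j] t].
  have k2 : (1 < 2 * k)%N by have := ltn_ord i; lia.
  have chain s : (s < 2 * k)%N ->
      y (i, j, inord s) = 2 ^+ s * y (i, j, ord0).
    elim: s => [_|s IHs sk].
      rewrite expr0 mul1r; congr (y (i, j, _)).
      by apply: val_inj; rewrite /= inordK.
    have /= := ysat (i, j, Ordinal sk); rewrite IHs ?(ltnW sk) // => <-.
    by rewrite exprS mulrA.
  (* After [chain], row 0 reads [b_i + b_j = 2 y + s]. Enumerating the 0/1 values of all four leaves
     only [y = b_i b_j] and [s] the exclusive or of [b_i] and [b_j]. *)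
  have /= := ysat (i, j, Ordinal (ltnW k2)).
  rewrite chain // expr1 /= !ffunE.
  have : y (j, j, ord0) = 0 \/ y (j, j, ord0) = 1 by apply: y01; left.
  have : y (i, i, ord0) = 0 \/ y (i, i, ord0) = 1 by apply: y01; left.
  have : y (i, j, ord0) = 0 \/ y (i, j, ord0) = 1 by apply: y01; left.
  have : y (i, j, ord_max) = 0 \/ y (i, j, ord_max) = 1 by apply: y01; right.
  have n01 : (0 == 1 :> R) = false by rewrite eq_sym oner_eq0.
  case: eqVneq => [->|tmax].
    by move=> [->|->] [->|->] [->|->] [->|->]; rewrite ?eqxx ?n01 /= => ?; lra.
  have tk : (t < 2 * k)%N.
    by have := ltn_ord t; rewrite ltnS leq_eqVlt => /orP[/eqP te|//];
      case/eqP: tmax; apply: val_inj.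
  have -> : t = inord t :> 'I_(2 * k).+1 by rewrite inord_val.
  rewrite chain // inordK ?ltn_ord //.
  by move=> [->|->] [->|->] [->|->] [->|->]; rewrite ?eqxx ?n01 //= => ?; lra.
move=> [b yE]; split; [|split].
- move=> [[i j] t]; rewrite yE /=; case: ifP => _.
    by apply: rpredB; rewrite -?mulrnA natr_int.
  by apply: rpredM; rewrite -?natrX natr_int.
- move=> [[i j] t] /=; have tk := ltn_ord t.
  have k1 : (1 < 2 * k)%N by have := ltn_ord i; lia.
  have -> : ord0 = inord 0 :> 'I_(2 * k).+1.
    by apply: val_inj; rewrite /= inordK.
  rewrite !yE; case: ifPn => t0.
    by rewrite !solution_inord ?(ltnW k1) // /= eqxx !andbb natrD; ring.
  by rewrite !solution_inord // ?mulrA -?exprS ?prednK ?lt0n //; lia.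
- move=> [[i j] t]; rewrite yE /= /upper_bound /=; case: eqVneq => [->|tm].
    by rewrite orbT !lee_fin; case: (b i); case: (b j) => /=; lra.
  rewrite orbF lee_fin mulr_ge0 ?exprn_ge0 //=.
  by case: eqVneq => [->|_]; rewrite ?leey // lee_fin mul1r lern1 leq_b1.
Qed.

Lemma weight_solution (R : realType) (k : nat) (b : {ffun 'I_k -> bool})
    (a : 'I_2) :
  \sum_v (weight a v)%:R * solution R b v =
  parabola_point R (binary_value b) a 0.
Proof.
transitivity (\sum_i \sum_j \sum_t
    (weight a (i, j, t))%:R * solution R b (i, j, t)).
  rewrite pair_bigA [RHS]pair_bigA.
  by apply: eq_bigr => -[[i j] t].
rewrite mxE.
have pick s (F : 'I_(2 * k).+1 -> R) : (s < 2 * k)%N ->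
    \sum_t (t == inord s)%:R * F t = F (inord s).
  move=> sk; rewrite (big_only1 (inord s)) // => [|t /negbTE -> _].
    by rewrite eqxx mul1r.
  by rewrite mul0r.
rewrite /weight /binary_value; case: ifP => a0.
  rewrite natr_sum; apply: eq_bigr => i _; rewrite (big_only1 i) //.
    under eq_bigr do rewrite eqxx andTb.
    have ik : (i < 2 * k)%N by have := ltn_ord i; lia.
    rewrite (pick i (fun t => solution R b (i, i, t))) // solution_inord //.
    by rewrite andbb natrM natrX mulrC.
  move=> j /negbTE ji _; apply: big1 => t _.
  by rewrite eq_sym ji mul0r.
rewrite natr_sum expr2 big_distrl /=; apply: eq_bigr => i _.
rewrite big_distrr /=; apply: eq_bigr => j _.
have ij : (i + j < 2 * k)%N by have := ltn_ord i; have := ltn_ord j; lia.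
rewrite (pick (i + j)%N (fun t => solution R b (i, j, t))) // solution_inord //.
by rewrite !natrM !natrX exprD -mulnb natrM; ring.
Qed.

(** * Matrix form and conclusion *)

(** Bridges matrix columns, indexed by ordinals, and the unknowns, indexed by triples. *)
Lemma sum_enum_val (R : realType) (T : finType) (f : T -> R)
    (x : 'cV[R]_#|T|) :
  \sum_j f (enum_val j) * x j 0 = \sum_v f v * x (enum_rank v) 0.
Proof.
rewrite [RHS](reindex (@enum_val T predT)) /=; last first.
  by apply: onW_bij; apply: enum_val_bij.
by apply: eq_bigr => j _; rewrite enum_valK.
Qed.

Theorem theorem3p3 (R : realType) (k : nat) (k_gt0 : (0 < k)%N) :
  exists (m n : nat) (A : 'M[R]_(m, n)) (W : 'M[R]_(2, n))
         (l u : 'cV[\bar R]_n),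
    ((0 < m < 4 * k ^ 4)%N /\ (0 < n < 4 * k ^ 4)%N) /\
    (forall i j, A i j \in [:: -1; 0; 1; 2]) /\
    (forall i j, W i j \in [:: 0; 1]) /\
    (forall j, l j 0 = -oo%E \/ l j 0 = 0%:E) /\
    (forall j, u j 0 = 1%:E \/ u j 0 = +oo%E) /\
    is_polytope (integer_hull A l u) /\
    (vertices [set (W *m x : 'cV[R]_2) | x in integer_hull A l u]
       #= `I_(2 ^ k))%card.
Proof.
pose A : 'M[R]_(#|equation k|, #|unknown k|) :=
  \matrix_(i, j) equation_coef R (enum_val i) (enum_val j).
pose W : 'M[R]_(2, #|unknown k|) := \matrix_(i, j) (weight i (enum_val j))%:R.
pose l : 'cV[\bar R]_#|unknown k| := \col_j 0%:E.
pose u : 'cV[\bar R]_#|unknown k| := \col_j upper_bound R (enum_val j).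
pose sol b : 'cV[R]_#|unknown k| := \col_j solution R b (enum_val j).
exists #|equation k|, #|unknown k|, A, W, l, u.
(* The feasible integer points are exactly the [sol b], one for each of the finitely many digit
   vectors. *)
have hullE : integer_hull A l u = convex_hull (range sol).
  congr convex_hull; apply/seteqP; split=> [x [xint xA xbd]|_ [b _ <-]].
    have [|b bE] := (solutions_of_system (fun v => x (enum_rank v) 0)).1.
      split=> //; split=> [r|v].
        apply/equation_coefE; rewrite -(sum_enum_val (equation_coef R r)).
        move/colP/(_ (enum_rank r)): xA; rewrite !mxE => xA.
        rewrite -[RHS]xA; apply: eq_bigr => j _.
        by rewrite mxE enum_rankK.
      by have := xbd (enum_rank v); rewrite !mxE enum_rankK.
    by exists b => //; apply/colP => j; rewrite mxE -bE enum_valK.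
  have [|sint [ssat sbd]] := (@solutions_of_system R k (solution R b)).2.
    by exists b.
  split=> [j||j]; [by rewrite mxE | | by rewrite !mxE].
  apply/colP => i; rewrite !mxE; have /equation_coefE eq_i := ssat (enum_val i).
  rewrite -[RHS]eq_i.
  under eq_bigr do rewrite mxE.
  rewrite (sum_enum_val (equation_coef R (enum_val i))).
  by apply: eq_bigr => v _; rewrite mxE enum_rankK.
have Wsol b : W *m sol b = parabola_point R (binary_value b).
  apply/matrixP => i j; rewrite ord1 -weight_solution mxE.
  under eq_bigr do rewrite [W _ _]mxE.
  rewrite (sum_enum_val (fun v => (weight i v)%:R)).
  by apply: eq_bigr => v _; rewrite mxE enum_rankK.
have WS : [set W *m x | x in range sol] =
    [set parabola_point R a | a in `I_(2 ^ k)].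
  have valE := range_binary_value k.
  apply/seteqP; split=> [_ [_ [b _ <-] <-]|_ [a + <-]].
    by exists (binary_value b); rewrite ?Wsol // -valE; exists b.
  by rewrite -valE => -[b _ <-]; exists (sol b); [exists b|].
(* Here [m = 2k^3] and [n = 2k^3 + k^2 <= 3k^3], both below [4k^4]. *)
split; first by rewrite !card_prod !card_ord; split; nia.
split; first by move=> i j; rewrite mxE equation_coef_in.
split.
  by move=> i j; rewrite mxE !inE; case: (weight _ _); rewrite eqxx ?orbT.
split; first by move=> j; right; rewrite mxE.
split; first by move=> j; rewrite mxE /upper_bound; case: ifP; [left|right].
rewrite hullE; split.
  by exists (range sol) => //; apply/finite_image/finite_finset.
rewrite (vertices_parabola WS); apply: inj_card_eq.
by apply: in2W; apply: parabola_point_inj.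
Qed.
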